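(* Let $m\ge2$, let $L=T_{m,m}$ be the $(m,m)$-torus link, let $f:\pi_1(S^3\setminus T_{m,m})\to G$ be a group homomorphism with $z_i:=f(\alpha_i)$, let $M,M'$ be right $G$-modules, $A$ an abelian group, and $\psi:M\otimes M'\to A$ a $G$-invariant bilinear function. For any $\ell$ with $1\le\ell\le m$, the bilinear form $\mathcal{Q}_{\psi,\ell}:\mathrm{Ker}(\Gamma_f)\otimes\mathrm{Ker}(\Gamma'_f)\to A$ takes $(x_1,\dots,x_m)\otimes(y_1',\dots,y_m')$ to $$\sum_{k=1}^{m-1}\psi\Bigl(\sum_{j=1}^{k}(x_{j+\ell-1}-x_{j+\ell})\cdot z_{j+\ell}\,z_{j+\ell+1}\cdots z_{k+\ell-1},\ \ y'_{k+\ell}\cdot(1-z_{k+\ell}^{-1})\Bigr)\in A,$$ where all indices are taken modulo $m$ and the product $z_{j+\ell}\cdots z_{k+\ell-1}$ is empty (equal to $1$) when $j=k$.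
   Context: Diagram: $D$ is the standard diagram of $T_{m,m}$ with all crossings positive, with $m$ distinguished arcs $\alpha_1,\dots,\alpha_m$ (indices mod $m$), one on each component, such that travelling along the $\ell$-th component from $\alpha_\ell$ one passes under $\alpha_{\ell+1},\alpha_{\ell+2},\dots,\alpha_{\ell+m-1}$ in this order and returns to $\alpha_\ell$; these are all the crossings. The meridians of the $\alpha_i$ generate the link group. Quandle: $X=M\times G$ with $(a,g)\lhd(b,h)=((a-b)\cdot h+b,\ h^{-1}gh)$, and $X'=M'\times G$ similarly. A coloring is a map $\mathcal{C}$ from the arcs of $D$ to $X$ such that, at each (positive) crossing $\tau$ with over-arc $\beta_\tau$, incoming under-arc $\alpha_\tau$ and outgoing under-arc $\gamma_\tau$, $\mathcal{C}(\alpha_\tau)\lhd\mathcal{C}(\beta_\tau)=\mathcal{C}(\gamma_\tau)$. Colorings whose $G$-component is $f$ form the group $\mathrm{Col}_X(D_f)$; writing $\mathcal{C}(\alpha_i)=(x_i,z_i)$, such a coloring is determined by $(x_1,\dots,x_m)$, and $\mathrm{Col}_X(D_f)$ is identified with $\mathrm{Ker}(\Gamma_f)$, where $\Gamma_f:M^m\to M^m$ has $\ell$-th component $$\Gamma_{f,\ell}(\vec{x})=(x_{\ell-1}-x_\ell)+\sum_{\ell\le j\le\ell+m-2}(x_j-x_{j+1})\cdot z_{j+1}z_{j+2}\cdots z_{m+\ell-1},\qquad 1\le\ell\le m .$$ $\Gamma'_f:M'^m\to M'^m$ is the analogous map for $M'$. $G$-invariance: $\psi(x\cdot g,y\cdot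 g)=\psi(x,y)$. The form $\mathcal{Q}_{\psi,\ell}$ is defined by $$\mathcal{Q}_{\psi,\ell}(\mathcal{C},\mathcal{C}')=\sum_\tau\epsilon_\tau\,\psi\bigl(x_\tau-y_\tau,\ y'_\tau\cdot(1-h_\tau^{-1})\bigr),$$ where $\tau$ runs over the crossings whose under-arcs belong to the $\ell$-th component, $\epsilon_\tau$ is the sign of $\tau$ (here $+1$), $\mathcal{C}(\alpha_\tau)=(x_\tau,g_\tau)$, $\mathcal{C}(\beta_\tau)=(y_\tau,h_\tau)$, and $\mathcal{C}'(\beta_\tau)=(y'_\tau,h_\tau)$. *)

(* Defs.v *)
From HB Require Import structures.
From mathcomp Require Import all_boot all_order all_algebra.
From mathcomp Require Import boolp.

Set Implicit Arguments.
Unset Strict Implicit.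
Unset Printing Implicit Defensive.

Import GRing.Theory.
Local Open Scope ring_scope.
Local Open Scope quotient_scope.

(* In a word, [(a, false)] stands for the generator [a] and [(a, true)] for   *)
(* its inverse.                                                               *)
Section PresentedGroup.
Variables (gen : choiceType).
Local Notation word := (seq (gen * bool)).
Variable rel : word -> word -> Prop.

Inductive word_equiv : word -> word -> Prop :=
| We_refl u : word_equiv u u
| We_sym u v : word_equiv u v -> word_equiv v u
| We_trans v u w : word_equiv u v -> word_equiv v w -> word_equiv u w
| We_cat u u' v v' :
    word_equiv u u' -> word_equiv v v' -> word_equiv (u ++ v) (u' ++ v')
| We_cancel a b : word_equiv [:: (a, b); (a, ~~ b)] [::]
| We_rel u v : rel u v -> word_equiv u v.

Definition word_equivb u v := `[< word_equiv u v >].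

Lemma word_equivb_refl : reflexive word_equivb.
Proof. by move=> u; apply/asboolP; exact: We_refl. Qed.

Lemma word_equivb_sym : symmetric word_equivb.
Proof. by move=> u v; apply/asboolP/asboolP; exact: We_sym. Qed.

Lemma word_equivb_trans : transitive word_equivb.
Proof. by move=> v u w /asboolP uv /asboolP vw; apply/asboolP/(We_trans uv). Qed.

Canonical word_equivb_equiv :=
  EquivRel word_equivb word_equivb_refl word_equivb_sym word_equivb_trans.

Definition presented := {eq_quot word_equivb}.

HB.instance Definition _ := Choice.on presented.
HB.instance Definition _ : EqQuotient _ word_equivb presented :=
  EqQuotient.on presented.

Lemma presentedP u v : reflect (word_equiv u v) (u == v %[mod presented]).
Proof. by rewrite piE; apply: asboolP. Qed.

Lemma word_equiv_repr u : word_equiv (repr (\pi_presented u)) u.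
Proof. by apply/presentedP; rewrite reprK. Qed.

Definition winv (u : word) : word := rev [seq (p.1, ~~ p.2) | p <- u].

Definition pone : presented := \pi_presented [::].
Definition pmul (x y : presented) : presented := \pi_presented (repr x ++ repr y).
Definition pinv (x : presented) : presented := \pi_presented (winv (repr x)).

Lemma pmulE u v : pmul (\pi_presented u) (\pi_presented v) = \pi_presented (u ++ v).
Proof. by apply/eqP/presentedP/We_cat; exact: word_equiv_repr. Qed.

Lemma winvK : involutive winv.
Proof.
move=> u; rewrite /winv map_rev revK -map_comp -[RHS]map_id.
by apply: eq_map => -[a b] /=; rewrite negbK.
Qed.

Lemma winv_mull u : word_equiv (winv u ++ u) [::].
Proof.
elim: u => [|[a b] u IH]; first exact: We_refl.
rewrite /winv /= rev_cons cat_rcons; apply: We_trans IH.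
apply: (We_cat (We_refl _)).
suff: word_equiv ([:: (a, ~~ b); (a, b)] ++ u) ([::] ++ u) by [].
apply: We_cat (We_refl _).
by have := We_cancel a (~~ b); rewrite negbK.
Qed.

Lemma pmulA : associative pmul.
Proof.
move=> x y z; rewrite -[x]reprK -[y]reprK -[z]reprK.
by rewrite (pmulE (repr y) (repr z)) (pmulE (repr x) (repr y)) !pmulE catA.
Qed.

Lemma pmul1 : left_id pone pmul.
Proof. by move=> x; rewrite -[x]reprK (pmulE [::]). Qed.

Lemma pmulr1 : right_id pone pmul.
Proof. by move=> x; rewrite -[x]reprK (pmulE _ [::]) cats0. Qed.

Lemma pmulV : left_inverse pone pinv pmul.
Proof.
move=> x; rewrite -{2}[x]reprK (pmulE _ (repr x)); apply/eqP/presentedP; exact: winv_mull.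
Qed.

Lemma pmulrV : right_inverse pone pinv pmul.
Proof.
move=> x; rewrite -{1}[x]reprK (pmulE (repr x)); apply/eqP/presentedP.
by rewrite -{1}[repr x]winvK; exact: winv_mull.
Qed.

HB.instance Definition _ :=
  isGroup.Build presented pmulA pmul1 pmulr1 pmulV pmulrV.

Definition pgen (a : gen) : presented := \pi_presented [:: (a, false)].

End PresentedGroup.

HB.mixin Record Zmodule_isRightGModule (G : groupType) M of GRing.Zmodule M := {
  gact : M -> G -> M;
  gactDl : forall g, {morph gact^~ g : x y / x + y};
  gact1 : forall x, gact x 1%g = x;
  gactM : forall x g h, gact x (g * h)%g = gact (gact x g) h
}.

#[short(type="rightGModType")]
HB.structure Definition RightGModule (G : groupType) :=
  {M of GRing.Zmodule M & Zmodule_isRightGModule G M}.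

Notation "x \cdot g" := (gact x g%g) (at level 40, left associativity).

Section GModuleTheory.
Variables (G : groupType) (M : rightGModType G).

Lemma gact0 (g : G) : (0 : M) \cdot g = 0.
Proof. by apply: (addrI (0 \cdot g)); rewrite -gactDl !addr0. Qed.

Lemma gactN (g : G) (x : M) : (- x) \cdot g = - (x \cdot g).
Proof. by apply: (addrI (x \cdot g)); rewrite -gactDl !subrr gact0. Qed.

Lemma gactB (g : G) (x y : M) : (x - y) \cdot g = x \cdot g - y \cdot g.
Proof. by rewrite gactDl gactN. Qed.

End GModuleTheory.

(* Stands for homomorphisms U (x) V -> W out of the tensor product over Z.    *)
Record bilinearZ (U V W : zmodType) := BilinearZ {
  bilinearZ_fun :> U -> V -> W;
  bilinearZDl : forall v, {morph bilinearZ_fun^~ v : u1 u2 / u1 + u2};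
  bilinearZDr : forall u, {morph bilinearZ_fun u : v1 v2 / v1 + v2}
}.

Definition G_invariant (G : groupType) (M M' : rightGModType G) (A : zmodType)
    (psi : bilinearZ M M' A) :=
  forall (x : M) (y : M') (g : G), psi (x \cdot g) (y \cdot g) = psi x y.

Definition quandle_op (G : groupType) (M : rightGModType G) (p q : M * G) :
    M * G :=
  ((p.1 - q.1) \cdot q.2 + q.1, (q.2^-1 * p.2 * q.2)%g).

(* The standard diagram of T_{m,m}, for [1 < m]. Components are indexed by    *)
(* 'Z_m, so that component m is component 0. The l-th component is cut by its *)
(* m - 1 under-passes into m - 1 arcs: [(l, 0)] is alpha_l, and [(l, k)] is   *)
(* the arc reached from alpha_l after k under-passes. ('Z_m is                *)
(* 'I_(m.-2).+2, and [(m.-2).+1] is m - 1 written as a successor.)            *)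
Definition arc (m : nat) : Type := ('Z_m * 'I_(m.-2).+1)%type.
HB.instance Definition _ m := Finite.on (arc m).

Definition alpha m (l : 'Z_m) : arc m := (l, ord0).

Definition component m (a : arc m) : 'Z_m := a.1.

(* The crossing [(l, k)] is the (k+1)-st under-pass of the l-th component     *)
(* travelling from alpha_l; [ordS] is the cyclic successor, so the last one   *)
(* returns to alpha_l.                                                        *)
Definition crossing (m : nat) : Type := ('Z_m * 'I_(m.-2).+1)%type.
HB.instance Definition _ m := Finite.on (crossing m).

Definition over_arc m (t : crossing m) : arc m := alpha (t.1 + t.2.+1%:R).
Definition in_arc m (t : crossing m) : arc m := t.
Definition out_arc m (t : crossing m) : arc m := (t.1, ordS t.2).
Definition crossing_sign m (t : crossing m) : int := 1.

(* At a positive crossing, out = over^-1 * in * over, as in [quandle_op].     *)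
Variant wirtinger m : seq (arc m * bool) -> seq (arc m * bool) -> Prop :=
  Wirtinger (t : crossing m) :
    wirtinger [:: (in_arc t, false); (over_arc t, false)]
              [:: (over_arc t, false); (out_arc t, false)].

(* pi_1(S^3 \ T_{m,m}), by its Wirtinger presentation.                        *)
Definition link_group (m : nat) := presented (@wirtinger m).
HB.instance Definition _ m := Group.on (link_group m).

Definition meridian m (a : arc m) : link_group m := pgen (@wirtinger m) a.

Lemma meridian_wirtinger m (t : crossing m) :
  (meridian (in_arc t) * meridian (over_arc t) =
   meridian (over_arc t) * meridian (out_arc t))%g.
Proof.
rewrite /meridian /pgen.
have E u v : (\pi_(link_group m) u * \pi_(link_group m) v)%g =
    \pi_(link_group m) (u ++ v) by exact: pmulE.
by rewrite !E; apply/eqP/presentedP/We_rel.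
Qed.

Section Colorings.
Variables (m : nat) (G : groupType) (f : {multiplicative link_group m -> G}).

Definition zval (i : 'Z_m) : G := f (meridian (alpha i)).

Section OneModule.
Variable M : rightGModType G.

Definition is_coloring (C : {ffun arc m -> M * G}) :=
  [forall t, quandle_op (C (in_arc t)) (C (over_arc t)) == C (out_arc t)].

Definition G_component_is (C : {ffun arc m -> M * G}) :=
  [forall a, (C a).2 == f (meridian a)].

Record Col := MkCol {
  col_val :> {ffun arc m -> M * G};
  col_valP : is_coloring col_val && G_component_is col_val
}.

HB.instance Definition _ := [isSub for col_val].
HB.instance Definition _ := [Choice of Col by <:].

(* Colorings over f are added in their M-components, the G-component being    *)
(* fixed by f.                                                                *)
Definition col_fun (x : arc m -> M) : {ffun arc m -> M * G} :=
  [ffun a => (x a, f (meridian a))].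

Lemma meridian_conj (t : crossing m) :
  ((f (meridian (over_arc t)))^-1 * f (meridian (in_arc t)) *
   f (meridian (over_arc t)))%g = f (meridian (out_arc t)).
Proof. by rewrite -mulgA -gmulfM meridian_wirtinger gmulfM mulKg. Qed.

Lemma col_funP (x : arc m -> M) :
  (forall t, (x (in_arc t) - x (over_arc t)) \cdot f (meridian (over_arc t))
      + x (over_arc t) = x (out_arc t)) <->
  is_coloring (col_fun x) && G_component_is (col_fun x).
Proof.
split=> [xP|/andP[/forallP xP _] t]; last first.
  by have /eqP := xP t; rewrite /quandle_op !ffunE => -[].
apply/andP; split; apply/forallP => t; last by rewrite ffunE.
by rewrite /quandle_op !ffunE /= xP meridian_conj.
Qed.

Lemma col_G (C : Col) a : (C a).2 = f (meridian a).
Proof. by case: C => C /= /andP[_ /forallP/(_ a)/eqP]. Qed.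

Lemma colE (C : Col) : val C = col_fun (fun a => (C a).1).
Proof. by apply/ffunP => a; rewrite ffunE -(col_G C a); case: (C a). Qed.

Lemma col_eq (C : Col) t :
  ((C (in_arc t)).1 - (C (over_arc t)).1) \cdot f (meridian (over_arc t))
    + (C (over_arc t)).1 = (C (out_arc t)).1.
Proof.
have := col_valP C; rewrite [X in is_coloring X]colE [X in G_component_is X]colE.
by move/(@col_funP (fun a => (C a).1)); apply.
Qed.

Lemma col_inj (C D : Col) : (forall a, (C a).1 = (D a).1) -> C = D.
Proof.
move=> E; apply/val_inj/ffunP => a; apply/eqP.
by rewrite -pair_eqE /= E !col_G !eqxx.
Qed.

Fact col0_subproof :
  is_coloring (col_fun (fun=> 0)) && G_component_is (col_fun (fun=> 0)).
Proof. by apply/col_funP => t; rewrite subr0 gact0 addr0. Qed.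
Definition col0 : Col := MkCol col0_subproof.

Fact colN_subproof (C : Col) : is_coloring (col_fun (fun a => - (C a).1)) &&
  G_component_is (col_fun (fun a => - (C a).1)).
Proof. by apply/col_funP => t; rewrite -opprD gactN -opprD col_eq. Qed.
Definition colN (C : Col) : Col := MkCol (colN_subproof C).

Fact colD_subproof (C D : Col) :
  is_coloring (col_fun (fun a => (C a).1 + (D a).1)) &&
  G_component_is (col_fun (fun a => (C a).1 + (D a).1)).
Proof.
by apply/col_funP => t; rewrite opprD addrACA gactDl addrACA !col_eq.
Qed.
Definition colD (C D : Col) : Col := MkCol (colD_subproof C D).

Fact colDA : associative colD.
Proof. by move=> C D E; apply: col_inj => a; rewrite !ffunE /= addrA. Qed.
Fact colDC : commutative colD.
Proof. by move=> C D; apply: col_inj => a; rewrite !ffunE /= addrC. Qed.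
Fact col0D : left_id col0 colD.
Proof. by move=> C; apply: col_inj => a; rewrite !ffunE /= add0r. Qed.
Fact colND : left_inverse col0 colN colD.
Proof. by move=> C; apply: col_inj => a; rewrite !ffunE /= addNr. Qed.

HB.instance Definition _ := GRing.isZmodule.Build Col colDA colDC col0D colND.

Lemma colDE (C D : Col) a : ((C + D) a).1 = (C a).1 + (D a).1.
Proof. by rewrite /= ffunE. Qed.

(* The summation index is shifted: j stands for the residue l + j.            *)
Definition Gamma (x : {ffun 'Z_m -> M}) : {ffun 'Z_m -> M} :=
  [ffun l : 'Z_m => (x (l - 1) - x l) +
    \sum_(0 <= j < m.-1) (x (l + j%:R) - x (l + j.+1%:R)) \cdot
      (\prod_(j.+1 <= i < m) zval (l + i%:R))%g].

Definition in_ker_Gamma : {pred {ffun 'Z_m -> M}} := [pred x | Gamma x == 0].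

Lemma in_ker_GammaE x : (x \in in_ker_Gamma) = (Gamma x == 0).
Proof. by []. Qed.

Fact Gamma_zmod_morphism : zmod_morphism Gamma.
Proof.
move=> x y; apply/ffunP => l; rewrite !ffunE.
have E a b c d : (a - b) - (c - d) = (a - c) - (b - d) :> M.
  by rewrite !opprD !opprK addrACA.
rewrite E [in RHS]opprD [in RHS]addrACA; congr (_ + _).
rewrite -sumrB; apply: eq_bigr => j _.
by rewrite !ffunE E; exact: gactB.
Qed.
HB.instance Definition _ :=
  GRing.isZmodMorphism.Build _ _ Gamma Gamma_zmod_morphism.

Fact ker_Gamma_zmod_closed : zmod_closed in_ker_Gamma.
Proof.
split=> [|x y]; rewrite !in_ker_GammaE; first by rewrite raddf0.
by move=> /eqP xP /eqP yP; rewrite raddfB /= xP yP subr0.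
Qed.
HB.instance Definition _ :=
  GRing.isZmodClosed.Build _ in_ker_Gamma ker_Gamma_zmod_closed.

Record KerGamma := MkKerGamma {
  kerGamma_val :> {ffun 'Z_m -> M};
  kerGamma_valP : kerGamma_val \in in_ker_Gamma
}.
HB.instance Definition _ := [isSub for kerGamma_val].
HB.instance Definition _ := [Choice of KerGamma by <:].
HB.instance Definition _ := [SubChoice_isSubZmodule of KerGamma by <:].

(* The M-colour of the arc (l, k) forced by the colours x of the alpha_i.     *)
Fixpoint propagate (x : 'Z_m -> M) (l : 'Z_m) (k : nat) : M :=
  if k is k'.+1 then
    (propagate x l k' - x (l + k%:R)) \cdot zval (l + k%:R) + x (l + k%:R)
  else x l.

Hypothesis m_gt1 : (1 < m)%N.

Let mE : m.-1 = (m.-2).+1.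
Proof. by case: m m_gt1 => [|[]]. Qed.

Lemma Gamma_propagate (x : {ffun 'Z_m -> M}) l :
  Gamma x l = propagate x l m.-1 - x l.
Proof.
have natrm : m%:R = 0 :> 'Z_m by exact: pchar_Zp.
have lm1 : l + m.-1%:R = l - 1.
  by apply: (addIr 1); rewrite -addrA natr1 prednK ?natrm ?addr0 ?subrK // ltnW.
have P n : propagate x l n = x (l + n%:R) +
    \sum_(0 <= j < n) (x (l + j%:R) - x (l + j.+1%:R)) \cdot
      (\prod_(j.+1 <= i < n.+1) zval (l + i%:R))%g.
  elim: n => [|n IH]; first by rewrite big_geq // !addr0.
  rewrite [LHS]/= IH addrC; congr (_ + _).
  rewrite addrAC gactDl [RHS]big_nat_recr //= big_nat1 [RHS]addrC.
  congr (_ + _).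
  rewrite (big_morph (fun v : M => v \cdot _) (gactDl _) (gact0 _ _)) !big_nat.
  apply: eq_bigr => j /andP[_ jn].
  by rewrite -gactM [in RHS]big_nat_recr //= ltnS ltnW.
rewrite P ffunE lm1 prednK ?(ltnW m_gt1) //.
by rewrite addrAC.
Qed.

Lemma Gamma_eq0P (x : {ffun 'Z_m -> M}) :
  reflect (forall l, propagate x l m.-1 = x l) (x \in in_ker_Gamma).
Proof.
rewrite in_ker_GammaE; apply: (iffP eqP) => [G0 l|xP].
  by apply/eqP; rewrite -subr_eq0 -Gamma_propagate G0 ffunE.
by apply/ffunP => l; rewrite Gamma_propagate xP subrr ffunE.
Qed.

Lemma propagate_col (C : Col) (l : 'Z_m) (k : nat) (lek : (k <= m.-2)%N) :
  propagate (fun i => (C (alpha i)).1) l k = (C (l, inord k)).1.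
Proof.
elim: k lek => [|k IH] lek.
  by rewrite /= /alpha; congr ((C (_, _)).1); apply/val_inj; rewrite /= inordK.
rewrite [LHS]/= IH ?(ltnW lek) //.
have := col_eq C (l, inord k); rewrite /in_arc /over_arc /out_arc /=.
rewrite inordK ?ltnS ?(ltnW lek) // => ->; congr ((C (_, _)).1).
by apply/val_inj; rewrite /= !inordK ?ltnS ?(ltnW lek) // modn_small.
Qed.

Fact restr_subproof (C : Col) : [ffun i => (C (alpha i)).1] \in in_ker_Gamma.
Proof.
apply/Gamma_eq0P => l; rewrite ffunE.
have E k : propagate [ffun i => (C (alpha i)).1] l k =
    propagate (fun i => (C (alpha i)).1) l k.
  by elim: k => [|k IH] /=; rewrite ?IH !ffunE.
rewrite E mE [LHS]/= propagate_col //.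
have := col_eq C (l, inord m.-2); rewrite /in_arc /over_arc /out_arc /=.
rewrite inordK // => ->; congr ((C (_, _)).1).
by apply/val_inj; rewrite /= inordK // modnn.
Qed.

(* The identification of Col_X(D_f) with Ker(Gamma_f).                        *)
Definition ker_of_col (C : Col) : KerGamma := MkKerGamma (restr_subproof C).

Fact col_of_ker_subproof (x : KerGamma) :
  is_coloring (col_fun (fun a => propagate x a.1 a.2)) &&
  G_component_is (col_fun (fun a => propagate x a.1 a.2)).
Proof.
apply/col_funP => -[l k]; rewrite /in_arc /over_arc /out_arc /=.
have [lt|ge] := ltnP k.+1 (m.-2).+1; first by rewrite modn_small.
have -> : (k : nat) = m.-2.
  by apply/eqP; rewrite eqn_leq -ltnS ltn_ord.
by rewrite modnn /= -[RHS](Gamma_eq0P _ (valP x)) mE.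
Qed.

Definition col_of_ker (x : KerGamma) : Col := MkCol (col_of_ker_subproof x).

Lemma col_of_kerK : cancel col_of_ker ker_of_col.
Proof. by move=> x; apply/val_inj/ffunP => i; rewrite !ffunE. Qed.

Lemma ker_of_colK : cancel ker_of_col col_of_ker.
Proof.
move=> C; apply: col_inj => -[l k]; rewrite ffunE /=.
have km : (k <= m.-2)%N by rewrite -ltnS.
rewrite -[in RHS](inord_val k) -propagate_col //.
by elim: (k : nat) => [|n IH] /=; rewrite ?IH !ffunE.
Qed.

Lemma ker_of_colD : {morph ker_of_col : C D / C + D}.
Proof. by move=> C D; apply/val_inj/ffunP => i; rewrite !ffunE. Qed.

Lemma col_of_kerD : {morph col_of_ker : x y / x + y}.
Proof.
by move=> x y; apply: (can_inj ker_of_colK); rewrite ker_of_colD !col_of_kerK.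
Qed.

End OneModule.
End Colorings.

Section Form.
Variables (m : nat) (G : groupType) (f : {multiplicative link_group m -> G}).
Variables (M M' : rightGModType G) (A : zmodType) (psi : bilinearZ M M' A).

(* y . (1 - h^-1), in the Z[G]-module notation, is y - y . h^-1.              *)
Definition colForm_fun (l : 'Z_m) (C : Col f M) (C' : Col f M') : A :=
  \sum_(t : crossing m | component (in_arc t) == l)
    psi ((C (in_arc t)).1 - (C (over_arc t)).1)
        ((C' (over_arc t)).1
           - (C' (over_arc t)).1 \cdot (C (over_arc t)).2^-1)
    *~ crossing_sign t.

Fact colFormDl l C' : {morph (colForm_fun l)^~ C' : C D / C + D}.
Proof.
move=> C D; rewrite -big_split; apply: eq_bigr => t _ /=.
rewrite !col_G /crossing_sign !mulr1z -bilinearZDl.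
by rewrite !ffunE /= opprD addrACA.
Qed.

Fact colFormDr l C : {morph colForm_fun l C : C' D / C' + D}.
Proof.
move=> C' D; rewrite -big_split; apply: eq_bigr => t _ /=.
rewrite /crossing_sign !mulr1z -bilinearZDr; congr (psi _ _).
by rewrite !ffunE /= gactDl opprD addrACA.
Qed.

Definition colForm l : bilinearZ (Col f M) (Col f M') A :=
  BilinearZ (colFormDl l) (colFormDr l).

Hypothesis m_gt1 : (1 < m)%N.

Definition Q_fun l (x : KerGamma f M) (y : KerGamma f M') : A :=
  colForm l (col_of_ker m_gt1 x) (col_of_ker m_gt1 y).

Fact QDl l y : {morph (Q_fun l)^~ y : x1 x2 / x1 + x2}.
Proof. by move=> x1 x2; rewrite /Q_fun col_of_kerD bilinearZDl. Qed.

Fact QDr l x : {morph Q_fun l x : y1 y2 / y1 + y2}.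
Proof. by move=> y1 y2; rewrite /Q_fun col_of_kerD bilinearZDr. Qed.

Definition Q l : bilinearZ (KerGamma f M) (KerGamma f M') A :=
  BilinearZ (QDl l) (QDr l).

End Form.

(* Main.v *)
Require Import Defs.
From mathcomp Require Import all_boot all_order all_algebra.

Set Implicit Arguments.
Unset Strict Implicit.
Unset Printing Implicit Defensive.

Import GRing.Theory.
Local Open Scope ring_scope.

(** The crossings on the l-th component are its successive under-passes beneath
    alpha_(l+1), ..., alpha_(l+m-1), so both sides are sums of [m - 1] terms
    and are compared term by term. At the k-th under-pass the over-arc is
    alpha_(l+k), so the second arguments of [psi] agree as they stand. The
    first one is the difference between the incoming color and x_(l+k); passing
    from one under-pass to the next acts on this difference by z_(l+k) and adds
    x_(l+k) - x_(l+k+1), and unrolling that affine recursion gives the inner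
    sum ([propagate_sub_over]). *)

(** The differences d_k between the incoming color and the over-arc color at
    under-pass [k.+1] satisfy d_(k+1) = d_k . z_(l+k+1) + (x_(l+k+1) - x_(l+k+2)):
    the quandle operation recenters at the over-arc color, so subtracting the
    next over-arc color leaves the difference of two consecutive ones. *)
Lemma propagate_sub_over (m : nat) (G : groupType)
    (f : {multiplicative link_group m -> G}) (M : rightGModType G)
    (x : 'Z_m -> M) (l : 'Z_m) (k : nat) :
  propagate f x l k - x (l + k.+1%:R) =
  \sum_(1 <= j < k.+2)
     (x (l + j%:R - 1) - x (l + j%:R)) \cdot
       (\prod_(j <= i < k.+1) zval f (l + i%:R))%g.
Proof.
have predE j : l + j.+1%:R - 1 = l + j%:R by rewrite -natr1 addrA addrK.
elim: k => [|k IH]; first by rewrite big_nat1 big_geq // (@gact1 G M) addrK.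
rewrite big_nat_recr //= (big_geq (leqnn k.+2)) (@gact1 G M) predE.
rewrite -[in LHS]addrA IH; congr (_ + _).
rewrite (big_morph (fun v : M => v \cdot _) (gactDl _) (gact0 _ _)) !big_nat.
apply: eq_bigr => j /andP[_ jk].
by rewrite -gactM [in RHS]big_nat_recr.
Qed.

Theorem proposition4p6 (m : nat) (m_gt1 : (1 < m)%N) (G : groupType)
    (f : {multiplicative link_group m -> G}) (M M' : rightGModType G)
    (A : zmodType) (psi : bilinearZ M M' A) (psi_inv : G_invariant psi)
    (l : 'Z_m) (x : KerGamma f M) (y' : KerGamma f M') :
  Q f psi m_gt1 l x y' =
  \sum_(1 <= k < m)
    psi (\sum_(1 <= j < k.+1)
           (x (l + j%:R - 1) - x (l + j%:R)) \cdot
             (\prod_(j <= i < k) zval f (l + i%:R))%g)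
        (y' (l + k%:R) - y' (l + k%:R) \cdot (zval f (l + k%:R))^-1).
Proof.
have mE : m.-1 = (m.-2).+1 by case: (m) m_gt1 => [|[]].
rewrite big_add1 mE big_mkord /= /Q_fun /= /colForm_fun.
pose F (a : 'Z_m) (k : 'I_(m.-2).+1) :=
  psi (propagate f x a k - x (a + k.+1%:R))
      (y' (a + k.+1%:R) - y' (a + k.+1%:R) \cdot (zval f (a + k.+1%:R))^-1).
(* The trivial conjunct splits the condition into one per coordinate, as
   [pair_big] expects. *)
transitivity (\sum_(t : crossing m | (t.1 == l) && true) F t.1 t.2).
  apply: eq_big => [t|t _]; first by rewrite andbT.
  by rewrite /= !ffunE.
rewrite -(pair_big (pred1 l) xpredT F) big_pred1_eq.
by apply: eq_bigr => k _; rewrite /F propagate_sub_over.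
Qed.
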